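(* Let $k\in\{1,2,3\}$ and let $R,S$ be integers with $1\le S<R$. Then the series $$\frac{(-1)^k}{(q^S;q^R)_\infty(q^{R-S};q^R)_\infty}\sum_{j=k}^\infty(-1)^jq^{Rj(j+1)/2-Sj}\left(1-q^{S(2j+1)}\right),$$ expanded as a power series in $q$, has non-negative coefficients.
   Context: Here $(a;q)_\infty:=\prod_{j=0}^{\infty}(1-aq^j)$; in particular $(q^S;q^R)_\infty=\prod_{j\ge 0}(1-q^{S+jR})$ and $(q^{R-S};q^R)_\infty=\prod_{j\ge 0}(1-q^{R-S+jR})$. Throughout, $q$ is a complex number with $|q|<1$ (equivalently, identities may be read as identities of formal power series in $q$). *)

(* Defs.v *)
From HB Require Import structures.
From mathcomp Require Import all_boot all_order all_algebra.
From mathcomp Require Import boolp classical_sets.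
From mathcomp Require Import zify.

Set Implicit Arguments.
Unset Strict Implicit.
Unset Printing Implicit Defensive.

Import Order.TTheory GRing.Theory Num.Theory.
Local Open Scope ring_scope.

(* Formal power series; coef f n is the coefficient of q^n. *)
Record fps (R : Type) := Fps { coef : nat -> R }.

Notation "{ 'fps' R }" := (fps R) (at level 0, format "{ 'fps'  R }") : type_scope.

Lemma fpsP (R : Type) (f g : {fps R}) : (forall n, coef f n = coef g n) <-> f = g.
Proof.
split=> [|-> //]; case: f => f; case: g => g /= fg.
by congr Fps; apply/funext.
Qed.

HB.instance Definition _ (R : Type) := gen_eqMixin {fps R}.
HB.instance Definition _ (R : Type) := gen_choiceMixin {fps R}.

Section FpsRing.
Variable R : comUnitRingType.
Implicit Types f g h : {fps R}.

Definition fps_zero : {fps R} := Fps (fun=> 0).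
Definition fps_opp f : {fps R} := Fps (fun n => - coef f n).
Definition fps_add f g : {fps R} := Fps (fun n => coef f n + coef g n).
Definition fps_one : {fps R} := Fps (fun n => (n == 0)%:R).
Definition fps_mul f g : {fps R} :=
  Fps (fun n => \sum_(i < n.+1) coef f i * coef g (n - i)).

Fact fps_addA : associative fps_add.
Proof. by move=> f g h; apply/fpsP => n /=; rewrite addrA. Qed.
Fact fps_addC : commutative fps_add.
Proof. by move=> f g; apply/fpsP => n /=; rewrite addrC. Qed.
Fact fps_add0 : left_id fps_zero fps_add.
Proof. by move=> f; apply/fpsP => n /=; rewrite add0r. Qed.
Fact fps_addN : left_inverse fps_zero fps_opp fps_add.
Proof. by move=> f; apply/fpsP => n /=; rewrite addNr. Qed.

HB.instance Definition _ :=
  GRing.isZmodule.Build {fps R} fps_addA fps_addC fps_add0 fps_addN.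

Definition fps_trunc m f : {poly R} := \poly_(i < m) coef f i.

Lemma coef_fps_trunc m f n : (n < m)%N -> (fps_trunc m f)`_n = coef f n.
Proof. by move=> nm; rewrite coef_poly nm. Qed.

Lemma coef_fps_mul_trunc m f g n : (n < m)%N ->
  coef (fps_mul f g) n = (fps_trunc m f * fps_trunc m g)`_n.
Proof.
move=> nm; rewrite coefM /=; apply: eq_bigr => i _.
by rewrite !coef_fps_trunc //; case: i => i /=; lia.
Qed.

Fact fps_mulC : commutative fps_mul.
Proof. by move=> f g; apply/fpsP => n; rewrite !(@coef_fps_mul_trunc n.+1) // mulrC. Qed.

Fact fps_mulA : associative fps_mul.
Proof.
move=> f g h; apply/fpsP => n.
have trM (u v : {fps R}) (p : {poly R}) :
    ((fps_trunc n.+1 (fps_mul u v)) * p)`_n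
    = (fps_trunc n.+1 u * fps_trunc n.+1 v * p)`_n.
  rewrite !coefM; apply: eq_bigr => i _; congr (_ * _).
  by rewrite coef_fps_trunc ?(@coef_fps_mul_trunc n.+1) //; case: i.
rewrite fps_mulC !(@coef_fps_mul_trunc n.+1) // !trM.
by rewrite mulrC mulrA.
Qed.

Fact fps_mul1 : left_id fps_one fps_mul.
Proof.
move=> f; apply/fpsP => n /=; rewrite big_ord_recl /= mul1r subn0.
by rewrite big1 ?addr0 // => i _; rewrite mul0r.
Qed.

Fact fps_mulDl : left_distributive fps_mul fps_add.
Proof.
move=> f g h; apply/fpsP => n /=; rewrite -big_split /=.
by apply: eq_bigr => i _; rewrite mulrDl.
Qed.

Fact fps_one_neq0 : fps_one != 0.
Proof.
by apply/eqP => /fpsP /(_ 0); rewrite /= => /eqP; rewrite oner_eq0.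
Qed.

HB.instance Definition _ := GRing.Zmodule_isComNzRing.Build {fps R}
  fps_mulA fps_mulC fps_mul1 fps_mulDl fps_one_neq0.

Lemma coef_fps0 n : coef (0 : {fps R}) n = 0. Proof. by []. Qed.
Lemma coef_fps1 n : coef (1 : {fps R}) n = (n == 0)%:R. Proof. by []. Qed.
Lemma coef_fpsD f g n : coef (f + g) n = coef f n + coef g n. Proof. by []. Qed.
Lemma coef_fpsN f n : coef (- f) n = - coef f n. Proof. by []. Qed.
Lemma coef_fpsM f g n :
  coef (f * g) n = \sum_(i < n.+1) coef f i * coef g (n - i).
Proof. by []. Qed.

(* First n coefficients of the inverse of f, obtained by solving f * g = 1
   degree by degree. *)
Fixpoint fps_inv_seq f n : seq R :=
  if n is m.+1 then
    let s := fps_inv_seq f m in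
    rcons s ((coef f 0)^-1 *
             ((m == 0)%:R - \sum_(i < m) coef f (m - i) * s`_i))
  else [::].

Definition fps_unit : {pred {fps R}} := fun f => coef f 0 \is a GRing.unit.

Definition fps_inv f : {fps R} :=
  if f \in fps_unit then Fps (fun n => (fps_inv_seq f n.+1)`_n) else f.

Lemma size_fps_inv_seq f n : size (fps_inv_seq f n) = n.
Proof. by elim: n => //= n IH; rewrite size_rcons IH. Qed.

Lemma nth_fps_inv_seq f n i : (i < n)%N ->
  (fps_inv_seq f n)`_i = (fps_inv_seq f i.+1)`_i.
Proof.
elim: n => // n IH; rewrite ltnS leq_eqVlt => /orP[/eqP -> //|lin].
by rewrite [in LHS]/= nth_rcons size_fps_inv_seq lin IH.
Qed.

Fact fps_mulV : {in fps_unit, left_inverse 1 fps_inv *%R}.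
Proof.
move=> f fU; rewrite /fps_inv fU; apply/fpsP => n; rewrite coef_fpsM coef_fps1.
rewrite big_ord_recr /= subnn nth_rcons size_fps_inv_seq ltnn eqxx.
rewrite mulrAC mulVr // mul1r addrC -[RHS]addr0 -addrA; congr (_ + _).
apply/eqP; rewrite addrC subr_eq0; apply/eqP; apply: eq_bigr => i _.
by rewrite mulrC -[rcons _ _]/(fps_inv_seq f i.+1) (@nth_fps_inv_seq f n).
Qed.

Fact fps_unitPl f g : g * f = 1 -> fps_unit f.
Proof.
move=> /fpsP/(_ 0); rewrite coef_fpsM big_ord1 coef_fps1 /= => gf.
by apply/unitrPr; exists (coef g 0); rewrite mulrC.
Qed.

Fact fps_inv_out : {in [predC fps_unit], fps_inv =1 id}.
Proof. by move=> f /negPf fU; rewrite /fps_inv fU. Qed.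

HB.instance Definition _ := GRing.ComNzRing_hasMulInverse.Build {fps R}
  fps_mulV fps_unitPl fps_inv_out.

Lemma fps_unitE f : (f \is a GRing.unit) = (coef f 0 \is a GRing.unit).
Proof. by []. Qed.

Definition fpsX : {fps R} := Fps (fun n => (n == 1)%:R).

Lemma coef_fpsXM f n : coef (fpsX * f) n = if n is m.+1 then coef f m else 0.
Proof.
rewrite coef_fpsM; case: n => [|n]; first by rewrite big_ord1 /= mul0r.
rewrite 2!big_ord_recl /= mul0r add0r mul1r subSS subn0 big1 ?addr0 // => i _.
by rewrite mul0r.
Qed.

Lemma coef_fpsXnM d f n :
  coef (fpsX ^+ d * f) n = if (n < d)%N then 0 else coef f (n - d).
Proof.
elim: d n => [|d IH] n; first by rewrite mul1r subn0.
by rewrite exprS -mulrA coef_fpsXM; case: n => // n; rewrite IH subSS.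
Qed.

(* Convergence in the q-adic topology: each coefficient is eventually constant. *)
Definition fps_cvg (u : nat -> {fps R}) f : Prop :=
  forall n, exists N, forall m, (N <= m)%N -> coef (u m) n = coef f n.

(* Defaults to 0 when u does not converge. *)
Definition fps_lim (u : nat -> {fps R}) : {fps R} := xget 0 [set f | fps_cvg u f]%classic.

Lemma fps_cvg_unique u f g : fps_cvg u f -> fps_cvg u g -> f = g.
Proof.
move=> uf ug; apply/fpsP => n; have [N HN] := uf n; have [M HM] := ug n.
by rewrite -(HN (maxn N M)) ?leq_maxl // HM // leq_maxr.
Qed.

Lemma fps_cvg_lim u f : fps_cvg u f -> fps_lim u = f.
Proof. by move=> uf; apply: xget_unique => // g ug; exact: fps_cvg_unique ug uf. Qed.

Definition fps_sum k (u : nat -> {fps R}) : {fps R} :=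
  fps_lim (fun m => \sum_(k <= j < m) u j).

Definition qpoch (a q : {fps R}) : {fps R} :=
  fps_lim (fun m => \prod_(0 <= j < m) (1 - a * q ^+ j)).

Lemma fps_stable_cvg u :
  (forall n m, (n < m)%N -> coef (u m.+1) n = coef (u m) n) ->
  fps_cvg u (fps_lim u) /\ forall n m, (n < m)%N -> coef (fps_lim u) n = coef (u m) n.
Proof.
move=> ust.
have ust' n m : (n < m)%N -> coef (u m) n = coef (u n.+1) n.
  elim: m => // m IH; rewrite ltnS leq_eqVlt => /orP[/eqP -> //|lnm].
  by rewrite ust // IH.
have uc : fps_cvg u (Fps (fun n => coef (u n.+1) n)).
  by move=> n; exists n.+1 => m nm /=; exact: ust'.
by rewrite (fps_cvg_lim uc); split=> // n m /ust' ->.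
Qed.

Lemma fps_sum_cvg k u : (forall n j, (n < j)%N -> coef (u j) n = 0) ->
  fps_cvg (fun m => \sum_(k <= j < m) u j) (fps_sum k u).
Proof.
move=> uj; apply: (fps_stable_cvg _).1 => n m nm.
case: (leqP k m) => km; last by rewrite !big_geq // ltnW.
have -> : \sum_(k <= j < m.+1) u j = \sum_(k <= j < m) u j + u m
  by rewrite big_nat_recr.
by rewrite coef_fpsD uj // addr0.
Qed.

Lemma qpoch_stable a b : (0 < b)%N ->
  let u m : {fps R} := \prod_(0 <= j < m) (1 - fpsX ^+ a * (fpsX ^+ b) ^+ j) in
  forall n m, (n < m)%N -> coef (u m.+1) n = coef (u m) n.
Proof.
move=> b0 u n m nm; have -> : u m.+1 = u m * (1 - fpsX ^+ a * (fpsX ^+ b) ^+ m) by rewrite /u big_nat_recr.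
rewrite mulrBr mulr1 coef_fpsD coef_fpsN -exprM -exprD mulrC coef_fpsXnM.
have -> : (n < a + b * m)%N by nia.
by rewrite subr0.
Qed.

Lemma qpoch_cvg a b : (0 < b)%N ->
  fps_cvg (fun m => \prod_(0 <= j < m) (1 - fpsX ^+ a * (fpsX ^+ b) ^+ j))
          (qpoch (fpsX ^+ a) (fpsX ^+ b)).
Proof. by move=> b0; apply: (fps_stable_cvg _).1; exact: qpoch_stable. Qed.

Lemma qpoch_unit a b : (0 < a)%N -> (0 < b)%N ->
  qpoch (fpsX ^+ a) (fpsX ^+ b) \is a GRing.unit.
Proof.
move=> a0 b0; rewrite fps_unitE.
rewrite ((fps_stable_cvg (@qpoch_stable a b b0)).2 0%N 1%N) //.
rewrite big_nat1 mulr1 coef_fpsD coef_fpsN coef_fps1.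
by rewrite -[_ ^+ a]mulr1 coef_fpsXnM a0 subr0 unitr1.
Qed.

End FpsRing.

Arguments fpsX {R}.

(* The exponent R j (j + 1) / 2 - S j: the division is exact and, for S <= R,
   the natural-number subtraction is not truncated. *)
Lemma jtp_expE R S j : (S <= R)%N ->
  ((R * (j * j.+1)) %/ 2 - S * j)%N%:Z *+ 2
  = R%:Z * j%:Z * (j%:Z + 1) - 2 * S%:Z * j%:Z.
Proof.
move=> SR; have /dvdnP[c ec] : (2 %| j * j.+1)%N.
  by rewrite dvdn2 oddM /=; case: (odd j).
rewrite ec mulnA mulnK //.
have : (S * j <= R * c)%N by case: j ec => [|j] ec; nia.
by nia.
Qed.

Lemma jtp_sum_cvg R S k : (S < R)%N ->
  let u j : {fps int} := (-1) ^+ j * fpsX ^+ ((R * (j * j.+1)) %/ 2 - S * j)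
                         * (1 - fpsX ^+ (S * (2 * j + 1))) in
  fps_cvg (fun m => \sum_(k <= j < m) u j) (fps_sum k u).
Proof.
move=> SR u; apply: fps_sum_cvg => n j nj.
rewrite /u mulrAC mulrC coef_fpsXnM.
have jE := jtp_expE j (ltnW SR).
have le_j : (j <= (R * (j * j.+1)) %/ 2 - S * j)%N.
  set e := (_ - _)%N in jE *; clearbody e; case: j {u nj} jE => [|j] // jE; nia.
by rewrite (leq_trans nj).
Qed.

(* Main.v *)
Require Import Defs.
From mathcomp Require Import all_boot all_order all_algebra.
From mathcomp Require Import ring zify.

Import Order.TTheory GRing.Theory Num.Theory.
Local Open Scope ring_scope.

Set Implicit Arguments.
Unset Strict Implicit.

(** Write q for fpsX ^+ R, a for fpsX ^+ S and b for fpsX ^+ (R - S), so that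
    q = a b, and write g_m = 1 / (q;q)_m. By the Jacobi triple product the full
    theta series equals (a;q)(b;q)(q;q), all products being infinite, so the
    series of the theorem is

      (-1)^k ( (q;q) - T_k / ((a;q)(b;q)) ),

    where T_k is the sum of (-1)^j t_j over j < k ([theta_term]). For k <= 3 the
    polynomial T_k / (1 - a) is a combination with coefficients in Z[q] of the
    products (aq;q)_i (b;q)_i, 0 <= i < k. Euler's expansion
    1 / (c;q) = sum_m c^m g_m then turns -(-1)^k T_k / ((a;q)(b;q)) into

      sum_(m, n) (aq)^m b^n W(m + n) g_m g_n

    with a weight W that depends only on N = m + n:

      k = 1:  W = 1,
      k = 2:  W = q + q^2 - q^N              = q (1 - q^(N-1)) + q^2,
      k = 3:  W = q^3 + q^4 + q^5 - (q + q^2 + q^3 + q^4) q^N + q^(2N)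
                = q^3 (1 - q^(N-1)) (1 - q^(N-2)) + (q^4 + q^5) (1 - q^(N-1)).

    The factored forms show that W(m + n) g_m g_n is non-negative for N >= 1
    ([nonneg_one_sub_inv_qfact_pair], [nonneg_one_sub2_inv_qfact_pair]).

    What remains is the term m = n = 0, together with (-1)^k (q;q). Euler's
    pentagonal number theorem, which is the case (a, b) = (q, q^2) of the triple
    product with q^3 for q, says that (q;q) has coefficients in {-1, 0, 1}. Its
    initial terms cancel W(0) up to at most one monomial with coefficient 1, and
    its tail, which is at most q^e / (1 - q) in absolute value with e a
    pentagonal number ([nonneg_pent_tail]), is dominated by this monomial and the
    single term m = n = 1, namely q^2 W(2) / (1 - q)^2
    ([nonneg_quad_weight]). *)

(** * Finite q-products and the finite triple product *)

Definition qpochn {A : comUnitRingType} (a q : A) m :=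
  \prod_(0 <= j < m) (1 - a * q ^+ j).

Definition inv_qfact {A : comUnitRingType} (q : A) m := (qpochn q q m)^-1.

(** The terms of index j and -j-1 of the bilateral theta series, taken together
    and divided by (-1)^j; grouped in this way, all exponents are natural
    numbers. *)
Definition theta_term {A : comUnitRingType} (a b : A) j :=
  a ^+ 'C(j, 2) * b ^+ 'C(j.+1, 2) * (1 - a ^+ (2 * j + 1)).

Lemma qpochnS {A : comUnitRingType} (a q : A) m :
  qpochn a q m.+1 = qpochn a q m * (1 - a * q ^+ m).
Proof. by rewrite /qpochn big_nat_recr. Qed.

Lemma qpochn_unit {A : comUnitRingType} (q : A) m :
  (forall i, 1 - q ^+ i.+1 \is a GRing.unit) -> qpochn q q m \is a GRing.unit.
Proof.
move=> hq; elim: m => [|m IH]; first by rewrite /qpochn big_geq ?unitr1.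
by rewrite qpochnS unitrM IH -exprS hq.
Qed.

Lemma inv_qfactS {A : comUnitRingType} (q : A) m :
  (forall i, 1 - q ^+ i.+1 \is a GRing.unit) ->
  inv_qfact q m = inv_qfact q m.+1 * (1 - q ^+ m.+1).
Proof.
move=> hq; rewrite /inv_qfact qpochnS -exprS invrM ?qpochn_unit //.
by rewrite mulrAC mulVr // mul1r.
Qed.

Lemma inv_qfact0 {A : comUnitRingType} (q : A) : inv_qfact q 0 = 1.
Proof. by rewrite /inv_qfact /qpochn big_geq ?invr1. Qed.

(** Passing from M to M + 1 multiplies the product side (a;q)_(M+1) (b;q)_M of
    the finite triple product by (1 - a q^(M+1)) (1 - b q^M). The sum side obeys
    the same rule because
      t_j q^M (b + a^2 b) = q^(M-j) t_(j+1) + q^(M+1+j) t_(j-1),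
    so that the summand-by-summand discrepancy telescopes; the right-hand side
    is its explicit antidifference. *)
Lemma theta_telescope {A : comUnitRingType} (a b q : A) M J d : q = a * b ->
  (forall i, 1 - q ^+ i.+1 \is a GRing.unit) -> M = (J + d)%N ->
  \sum_(0 <= j < J.+1) (-1) ^+ j * theta_term a b j *
     ((1 - q ^+ (2 * M).+2) * (1 - q ^+ (2 * M).+3)
        * (inv_qfact q (M.+1 - j) * inv_qfact q (M.+2 + j))
      - (1 - a * q ^+ M.+1) * (1 - b * q ^+ M)
        * (inv_qfact q (M - j) * inv_qfact q (M.+1 + j)))
  = (-1) ^+ J * (inv_qfact q d * inv_qfact q (M.+2 + J)) *
    (q ^+ (M.+2 + J) * (1 - q ^+ d) * theta_term a b J
     + q ^+ d * (1 - q ^+ (M.+2 + J)) * theta_term a b J.+1).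
Proof.
move=> qE hq; elim: J d => [|J IH] d ME.
  have -> : M = d by [].
  rewrite big_nat1 !subn0 !addn0 (inv_qfactS d hq) (inv_qfactS d.+1 hq).
  rewrite /theta_term !binS !bin1 !bin0 !bin_small // !muln0 muln1 !expr0.
  rewrite mul2n -addnn !exprS !exprD qE.
  set u := (a * b) ^+ d; set g1 := inv_qfact _ _.
  ring.
rewrite big_nat_recr //= (IH d.+1); last by rewrite ME addSnnS.
have -> : (M.+1 - J.+1 = d.+1)%N by lia.
have -> : (M - J.+1 = d)%N by lia.
have -> : (M.+1 + J.+1 = M.+2 + J)%N by lia.
have -> : (M.+2 + J.+1 = (M.+2 + J).+1)%N by lia.
rewrite (inv_qfactS (M.+2 + J) hq) (inv_qfactS d hq).
set K1 := inv_qfact _ _; set K2 := inv_qfact _ _.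
have {hq IH} -> : M = (J + d).+1 by lia.
rewrite /theta_term !binS !bin1 !bin0 !mul2n -!addnn !addn1 !addnS !addSn ?(exprS, exprD).
rewrite qE exprMn.
set u := (a * b) ^+ d; set x := a ^+ J; set y := b ^+ J.
set x' := a ^+ _; set y' := b ^+ _; move: x' y' => x' y'.
ring.
Qed.

(** The q-binomial theorem in its symmetric form, with the q-binomial
    coefficient [2M+1 choose M-j] divided by (q;q)_(2M+1), which leaves
    g_(M-j) g_(M+1+j). In the induction on M, the antidifference of
    [theta_telescope] at J = M is exactly the new summand of index M + 1. *)
Lemma jtp_finite {A : comUnitRingType} (a b q : A) M : q = a * b ->
  (forall i, 1 - q ^+ i.+1 \is a GRing.unit) ->
  \sum_(0 <= j < M.+1) (-1) ^+ j * theta_term a b j *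
      (inv_qfact q (M - j) * inv_qfact q (M.+1 + j))
  = qpochn a q M.+1 * qpochn b q M * inv_qfact q (2 * M).+1.
Proof.
move=> qE hq; elim: M => [|M IH].
  rewrite big_nat1 /theta_term /qpochn big_nat1 big_geq // !bin_small // !expr0 inv_qfact0.
  by rewrite !mulr1 !mul1r.
(* It is enough to compare both sides after clearing the two new factors of
   (q;q)_(2M+3). *)
have cancel X Y : X * (1 - q ^+ (2 * M).+2) * (1 - q ^+ (2 * M).+3)
    = Y * (1 - q ^+ (2 * M).+2) * (1 - q ^+ (2 * M).+3) -> X = Y.
  by move=> /(mulIr (hq _)) /(mulIr (hq _)).
apply: cancel.
have -> : (2 * M.+1 = (2 * M).+2)%N by lia.
rewrite (qpochnS a q M.+1) (qpochnS b q M).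
set g := RHS; have {g} -> : g = (1 - a * q ^+ M.+1) * (1 - b * q ^+ M) *
    (qpochn a q M.+1 * qpochn b q M * (inv_qfact q (2 * M).+3 * (1 - q ^+ (2 * M).+3)
      * (1 - q ^+ (2 * M).+2))) by rewrite /g; ring.
rewrite -!inv_qfactS // -IH; apply/eqP; rewrite -subr_eq0 big_nat_recr //=.
have := @theta_telescope A a b q M M 0 qE hq (esym (addn0 M)).
rewrite subnn expr0 subrr mulr0 mul0r add0r !mul1r inv_qfact0 !mul1r.
have -> : (M.+2 + M = (2 * M).+2)%N by lia.
have -> : (M.+2 + M.+1 = (2 * M).+3)%N by lia.
move=> tel.
have: \sum_(0 <= j < M.+1) (-1) ^+ j * theta_term a b j *
     ((1 - q ^+ (2 * M).+2) * (1 - q ^+ (2 * M).+3)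
        * (inv_qfact q (M.+1 - j) * inv_qfact q (M.+2 + j))
      - (1 - a * q ^+ M.+1) * (1 - b * q ^+ M)
        * (inv_qfact q (M - j) * inv_qfact q (M.+1 + j)))
  = (1 - q ^+ (2 * M).+2) * (1 - q ^+ (2 * M).+3) *
     (\sum_(0 <= j < M.+1) (-1) ^+ j * theta_term a b j
        * (inv_qfact q (M.+1 - j) * inv_qfact q (M.+2 + j)))
   - (1 - a * q ^+ M.+1) * (1 - b * q ^+ M) *
     (\sum_(0 <= j < M.+1) (-1) ^+ j * theta_term a b j
        * (inv_qfact q (M - j) * inv_qfact q (M.+1 + j))).
  rewrite !mulr_sumr -sumrB; apply: eq_bigr => j _; ring.
rewrite tel => {}tel.
set s1 := \sum_(_ <= _ < _) _ in tel *; set s2 := \sum_(_ <= _ < _) _ in tel *.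
rewrite (_ : _ - _ = (1 - q ^+ (2 * M).+2) * (1 - q ^+ (2 * M).+3) * s1
   - (1 - a * q ^+ M.+1) * (1 - b * q ^+ M) * s2 - (-1) ^+ M * theta_term a b M.+1
     * (inv_qfact q (2 * M).+3 * (1 - q ^+ (2 * M).+3) * (1 - q ^+ (2 * M).+2))).
  by rewrite -tel (inv_qfactS (2 * M).+2 hq); apply/eqP; ring.
by rewrite exprS; ring.
Qed.

(** * Limits of formal power series *)

Section Cvg.
Variable R : comUnitRingType.
Implicit Types (u v : nat -> {fps R}) (f g : {fps R}).

Lemma fps_cvg_upto u f n : fps_cvg u f ->
  exists N, forall m, (N <= m)%N -> forall i, (i <= n)%N -> coef (u m) i = coef f i.
Proof.
move=> uf; elim: n => [|n [N HN]].
  by have [N HN] := uf 0; exists N => m Nm i; rewrite leqn0 => /eqP ->; exact: HN.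
have [N' HN'] := uf n.+1; exists (maxn N N') => m; rewrite geq_max => /andP[Nm N'm] i.
by rewrite leq_eqVlt => /orP[/eqP -> |]; [exact: HN'| exact: HN].
Qed.

Lemma fps_cvg_cst f : fps_cvg (fun=> f) f. Proof. by move=> n; exists 0. Qed.

Lemma fps_cvg_ext u v f : (forall m, u m = v m) -> fps_cvg u f -> fps_cvg v f.
Proof. by move=> uv uf n; have [N HN] := uf n; exists N => m /HN; rewrite uv. Qed.

Lemma fps_cvg_comp (h : nat -> nat) u f :
  (forall N, exists M, forall m, (M <= m)%N -> (N <= h m)%N) ->
  fps_cvg u f -> fps_cvg (fun m => u (h m)) f.
Proof.
move=> hh uf n; have [N HN] := uf n; have [M HM] := hh N.
by exists M => m /HM /HN.
Qed.

Lemma fps_cvgD u v f g : fps_cvg u f -> fps_cvg v g -> fps_cvg (fun m => u m + v m) (f + g).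
Proof.
move=> uf vg n; have [N HN] := uf n; have [M HM] := vg n.
exists (maxn N M) => m; rewrite geq_max => /andP[Nm Mm].
by rewrite !coef_fpsD HN // HM.
Qed.

Lemma fps_cvgN u f : fps_cvg u f -> fps_cvg (fun m => - u m) (- f).
Proof.
by move=> uf n; have [N HN] := uf n; exists N => m Nm; rewrite !coef_fpsN HN.
Qed.

Lemma fps_cvgM u v f g : fps_cvg u f -> fps_cvg v g -> fps_cvg (fun m => u m * v m) (f * g).
Proof.
move=> uf vg n; have [N HN] := fps_cvg_upto n uf; have [M HM] := fps_cvg_upto n vg.
exists (maxn N M) => m; rewrite geq_max => /andP[Nm Mm].
rewrite !coef_fpsM; apply: eq_bigr => i _; rewrite HN // ?HM ?leq_subr //.
by rewrite -ltnS.
Qed.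

(** Inversion is continuous because u^-1 - f^-1 = (f - u) u^-1 f^-1: agreement of
    u and f up to degree n passes to the inverses. *)
Lemma fps_cvgV u f : (forall m, u m \is a GRing.unit) -> f \is a GRing.unit ->
  fps_cvg u f -> fps_cvg (fun m => (u m)^-1) f^-1.
Proof.
move=> uU fU uf n; have [N HN] := fps_cvg_upto n uf; exists N => m Nm.
apply/eqP; rewrite -subr_eq0 -coef_fpsN -coef_fpsD; apply/eqP.
have -> : (u m)^-1 - f^-1 = (f - u m) * ((u m)^-1 * f^-1).
  by rewrite mulrBl mulrCA divrr // mulr1 mulrA divrr // mul1r.
rewrite coef_fpsM big1 // => i _.
by rewrite coef_fpsD coef_fpsN HN ?subrr ?mul0r // -ltnS.
Qed.

Lemma fps_cvg_bigsum (u : nat -> nat -> {fps R}) v J :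
  (forall j, fps_cvg (fun m => u m j) (v j)) ->
  fps_cvg (fun m => \sum_(0 <= j < J) u m j) (\sum_(0 <= j < J) v j).
Proof.
move=> uv; elim: J => [|J IH].
  by rewrite big_geq //; apply: fps_cvg_ext (fps_cvg_cst 0) => m; rewrite big_geq.
rewrite big_nat_recr //=; apply: fps_cvg_ext (fps_cvgD IH (uv J)) => m.
by rewrite big_nat_recr.
Qed.

Lemma coef_fps_bigsum v k K n :
  coef (\sum_(k <= j < K) v j) n = \sum_(k <= j < K) coef (v j) n.
Proof. exact: (big_morph (fun f => coef f n) (fun f g => coef_fpsD f g n) (coef_fps0 R n)). Qed.

Lemma coef_bigsum_small v k J K n : (forall j, (n < j)%N -> coef (v j) n = 0) ->
  (n < J <= K)%N -> (k <= J)%N ->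
  coef (\sum_(k <= j < K) v j) n = coef (\sum_(k <= j < J) v j) n.
Proof.
move=> v0 /andP[nJ JK] kJ; rewrite (big_cat_nat kJ JK) /=.
rewrite [X in _ + X]coef_fps_bigsum [X in _ + X]big_nat_cond [X in _ + X]big1 ?addr0 //.
move=> j /andP[/andP[Jj _] _].
by rewrite v0 // (leq_trans nJ).
Qed.

(** Tannery's theorem: as the j-th summand starts in degree j at the earliest,
    uniformly in m, only the first n + 1 summands matter in degree n. *)
Lemma fps_cvg_dominated (u : nat -> nat -> {fps R}) v :
  (forall m n j, (n < j)%N -> coef (u m j) n = 0) ->
  (forall j, fps_cvg (fun m => u m j) (v j)) ->
  fps_cvg (fun m => \sum_(0 <= j < m.+1) u m j) (fps_sum 0 v).
Proof.
move=> u0 uv.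
have v0 n j : (n < j)%N -> coef (v j) n = 0.
  by move=> nj; have [N /(_ N (leqnn N)) <-] := uv j n; exact: u0.
move=> n; have [N HN] := fps_cvg_bigsum n.+1 uv n.
have [N' HN'] := @fps_sum_cvg R 0 v v0 n.
exists (maxn N n.+1) => m; rewrite geq_max => /andP[Nm nm].
rewrite (@coef_bigsum_small _ 0 n.+1) // ?HN ?ltnSn ?(leq_trans nm) //; last exact: u0.
rewrite -(HN' (maxn N' n.+1)) ?leq_maxl //.
by rewrite (@coef_bigsum_small v 0 n.+1) ?leq_maxr ?ltnSn // => j; exact: v0.
Qed.

Lemma fps_sum_split u k : (forall n j, (n < j)%N -> coef (u j) n = 0) ->
  fps_sum k u = fps_sum 0 u - \sum_(0 <= j < k) u j.
Proof.
move=> u0; apply: fps_cvg_unique (fps_sum_cvg k u0) _.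
have := fps_cvgD (fps_sum_cvg 0 u0) (fps_cvg_cst (- \sum_(0 <= j < k) u j)).
move=> H n; have [N HN] := H n; exists (maxn k N) => m; rewrite geq_max => /andP[km Nm].
by rewrite -(HN _ Nm) (big_cat_nat (leq0n k) km) /= addrAC subrr add0r.
Qed.

End Cvg.

(** * Jacobi triple product and Euler expansion *)

Lemma coef_fpsXn_small (R : comUnitRingType) d n (f : {fps R}) :
  (n < d)%N -> coef (fpsX ^+ d * f) n = 0.
Proof. by move=> nd; rewrite coef_fpsXnM nd. Qed.

Lemma one_sub_fpsXn_unit (R : comUnitRingType) d :
  (0 < d)%N -> (1 - fpsX ^+ d : {fps R}) \is a GRing.unit.
Proof.
move=> d0; rewrite fps_unitE coef_fpsD coef_fpsN coef_fps1 -[_ ^+ d]mulr1.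
by rewrite coef_fpsXn_small // subr0 unitr1.
Qed.

Lemma one_sub_fpsXnX_unit (R : comUnitRingType) d i :
  (0 < d)%N -> (1 - (fpsX ^+ d) ^+ i.+1 : {fps R}) \is a GRing.unit.
Proof. by move=> d0; rewrite -exprM one_sub_fpsXn_unit // muln_gt0 d0. Qed.

Lemma inv_qfact_cvg (R : comUnitRingType) r : (0 < r)%N ->
  fps_cvg (inv_qfact (fpsX ^+ r : {fps R})) (qpoch (fpsX ^+ r) (fpsX ^+ r))^-1.
Proof.
move=> r0; apply: fps_cvgV (qpoch_cvg _ r r0) => [m|]; last exact: qpoch_unit.
by apply: qpochn_unit => i; exact: one_sub_fpsXnX_unit.
Qed.

Lemma theta_termX (R : comUnitRingType) s r j :
  theta_term (fpsX ^+ s) (fpsX ^+ r) j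
  = fpsX ^+ (s * 'C(j, 2) + r * 'C(j.+1, 2)) * (1 - fpsX ^+ (s * (2 * j + 1))) :> {fps R}.
Proof. by rewrite /theta_term -!exprM -exprD. Qed.

Lemma coef_theta_small (R : comUnitRingType) s r (f : {fps R}) j n : (0 < r)%N -> (n < j)%N ->
  coef ((-1) ^+ j * theta_term (fpsX ^+ s) (fpsX ^+ r) j * f) n = 0.
Proof.
move=> r0 nj; rewrite theta_termX mulrCA -mulrA coef_fpsXn_small //.
by rewrite binS bin1; nia.
Qed.

(** The limit M -> oo of [jtp_finite]: both g_(M-j) and g_(M+1+j) tend to
    1 / (q;q), which is why (q;q) ends up on the product side. *)
Lemma jacobi_triple_product (R : comUnitRingType) s r : (0 < s)%N -> (0 < r)%N ->
  fps_sum 0 (fun j => (-1) ^+ j * theta_term (fpsX ^+ s) (fpsX ^+ r) j)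
  = qpoch (fpsX ^+ s) (fpsX ^+ (s + r)) * qpoch (fpsX ^+ r) (fpsX ^+ (s + r))
    * qpoch (fpsX ^+ (s + r)) (fpsX ^+ (s + r)) :> {fps R}.
Proof.
move=> s0 r0; have q0 : (0 < s + r)%N by lia.
set t := fun j => _; set q := fpsX ^+ (s + r); set P := qpoch q q.
have PU : P \is a GRing.unit by exact: qpoch_unit.
have gP : fps_cvg (inv_qfact q) P^-1 by exact: inv_qfact_cvg.
have cvL : fps_cvg (fun M => \sum_(0 <= j < M.+1)
      t j * (inv_qfact q (M - j) * inv_qfact q (M.+1 + j)))
    (fps_sum 0 (fun j => t j * (P^-1 * P^-1))).
  apply: (@fps_cvg_dominated R
    (fun M j => t j * (inv_qfact q (M - j) * inv_qfact q (M.+1 + j)))).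
    by move=> m n j nj; exact: coef_theta_small.
  move=> j; apply: fps_cvgM (fps_cvg_cst _) (fps_cvgM _ _).
    by apply: fps_cvg_comp gP => N; exists (N + j)%N => m; lia.
  by apply: fps_cvg_comp gP => N; exists N => m; lia.
have cvL' : fps_cvg (fun m => \sum_(0 <= j < m) t j * (P^-1 * P^-1))
    (fps_sum 0 t * (P^-1 * P^-1)).
  have tc : fps_cvg (fun m => \sum_(0 <= j < m) t j) (fps_sum 0 t).
    by apply: fps_sum_cvg => n j nj; rewrite -[t j]mulr1 coef_theta_small.
  by apply: fps_cvg_ext (fps_cvgM tc (fps_cvg_cst _)) => m; rewrite mulr_suml.
have E1 : fps_sum 0 (fun j => t j * (P^-1 * P^-1)) = fps_sum 0 t * (P^-1 * P^-1).
  exact: fps_cvg_lim.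
rewrite {}E1 in cvL.
have cvR : fps_cvg
   (fun M => qpochn (fpsX ^+ s) q M.+1 * qpochn (fpsX ^+ r) q M * inv_qfact q (2 * M).+1)
   (qpoch (fpsX ^+ s) q * qpoch (fpsX ^+ r) q * P^-1).
  apply: fps_cvgM (fps_cvgM _ _) _.
  - by apply: fps_cvg_comp (qpoch_cvg _ s q0) => N; exists N => m; lia.
  - exact: qpoch_cvg.
  - by apply: fps_cvg_comp gP => N; exists N => m; lia.
have EQ : fps_sum 0 t * (P^-1 * P^-1) = qpoch (fpsX ^+ s) q * qpoch (fpsX ^+ r) q * P^-1.
  apply: fps_cvg_unique cvL _; apply: fps_cvg_ext cvR => M.
  rewrite /t -(@jtp_finite _ (fpsX ^+ s) (fpsX ^+ r)) //; first by rewrite /q exprD.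
  by move=> i; exact: one_sub_fpsXnX_unit.
rewrite mulrA in EQ; have PU' : P^-1 \is a GRing.unit by rewrite unitrV.
by rewrite -(mulIr PU' EQ) divrK.
Qed.

(** A finite form of E(c) (1 - c) = E(cq) for Euler's series
    E(c) = sum_m c^m g_m; the last term is the truncation error. *)
Lemma euler_partial {A : comUnitRingType} (c q : A) M :
  (forall i, 1 - q ^+ i.+1 \is a GRing.unit) ->
  (1 - c) * \sum_(0 <= m < M.+1) c ^+ m * inv_qfact q m
  = \sum_(0 <= m < M.+1) (c * q) ^+ m * inv_qfact q m - c ^+ M.+1 * inv_qfact q M.
Proof.
move=> hq; elim: M => [|M IH]; first by rewrite !big_nat1 !expr0 inv_qfact0; ring.
rewrite big_nat_recr //= [in RHS]big_nat_recr //= mulrDr IH (inv_qfactS M hq) !exprMn !exprS.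
ring.
Qed.

Lemma qpoch_rec (R : comUnitRingType) t r : (0 < r)%N ->
  qpoch (fpsX ^+ t) (fpsX ^+ r)
  = (1 - fpsX ^+ t) * qpoch (fpsX ^+ (t + r)) (fpsX ^+ r) :> {fps R}.
Proof.
move=> r0; apply: (@fps_cvg_unique _ (fun m => qpochn (fpsX ^+ t) (fpsX ^+ r) m.+1)).
  by apply: fps_cvg_comp (qpoch_cvg _ t r0) => N; exists N => m; lia.
apply: fps_cvg_ext (fps_cvgM (fps_cvg_cst _) (qpoch_cvg _ (t + r) r0)) => m.
rewrite /qpochn big_nat_recl //= expr0 mulr1; congr (_ * _).
by apply: eq_bigr => j _; rewrite exprS exprD mulrA.
Qed.

(** Iterating E(c) (1 - c) = E(cq) gives (c;q)_m E(c) = E(c q^m), and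
    E(c q^m) tends to 1. *)
Lemma euler_cvg (R : comUnitRingType) t r : (0 < t)%N -> (0 < r)%N ->
  fps_cvg (fun M => \sum_(0 <= m < M) (fpsX ^+ t) ^+ m * inv_qfact (fpsX ^+ r) m)
          (qpoch (fpsX ^+ t) (fpsX ^+ r) : {fps R})^-1.
Proof.
move=> t0 r0; set q := fpsX ^+ r.
pose E c : {fps R} := fps_sum 0 (fun m => (fpsX ^+ c) ^+ m * inv_qfact q m).
have small c n m : (0 < c)%N -> (n < m)%N -> coef ((fpsX ^+ c) ^+ m * inv_qfact q m) n = 0.
  by move=> c0 nm; rewrite -exprM coef_fpsXn_small //; nia.
have Ecvg c : (0 < c)%N ->
    fps_cvg (fun M => \sum_(0 <= m < M) (fpsX ^+ c) ^+ m * inv_qfact q m) (E c).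
  by move=> c0; apply: fps_sum_cvg => n m; exact: small.
have Erec c : (0 < c)%N -> (1 - fpsX ^+ c) * E c = E (c + r)%N.
  move=> c0; have shift (u : nat -> {fps R}) f : fps_cvg u f -> fps_cvg (fun m => u m.+1) f.
    by move=> uf; apply: fps_cvg_comp uf => N; exists N => m; lia.
  apply: fps_cvg_unique (fps_cvgM (fps_cvg_cst _) (shift _ _ (Ecvg c c0))) _.
  rewrite -[E _]subr0.
  have lim0 : fps_cvg (fun M => (fpsX ^+ c) ^+ M.+1 * inv_qfact q M) 0.
    by move=> n; exists n => m nm; rewrite -exprM coef_fpsXn_small //; nia.
  have c1 : (0 < c + r)%N by lia.
  apply: fps_cvg_ext (fps_cvgD (shift _ _ (Ecvg _ c1)) (fps_cvgN lim0)) => M.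
  rewrite euler_partial ?exprD // => i; exact: one_sub_fpsXnX_unit.
have Eprod m : qpochn (fpsX ^+ t) q m * E t = E (t + r * m)%N.
  elim: m => [|m IH]; first by rewrite /qpochn big_geq // mul1r muln0 addn0.
  rewrite qpochnS mulrAC IH mulnS addnCA (addnC r) -Erec; last by lia.
  by rewrite -exprM -exprD mulrC.
have Elim : fps_cvg (fun m => E (t + r * m)%N) 1.
  move=> n; exists n => m nm.
  have c0 : (0 < t + r * m)%N by lia.
  have [N /(_ N.+1 (leqnSn N)) <-] := Ecvg _ c0 n.
  have -> : \sum_(0 <= i < N.+1) (fpsX ^+ (t + r * m)) ^+ i * inv_qfact q i
    = 1 + \sum_(0 <= i < N) (fpsX ^+ (t + r * m)) ^+ i.+1 * inv_qfact q i.+1.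
    by rewrite big_nat_recl //= expr0 inv_qfact0 mulr1.
  rewrite coef_fpsD addrC -[X in _ = X]add0r; congr (_ + _).
  have: (n < t + r * m)%N by nia.
  by move=> nc; rewrite coef_fps_bigsum big1 // => i _; rewrite exprS -mulrA coef_fpsXn_small.
have E1 : qpoch (fpsX ^+ t) q * E t = 1.
  apply: fps_cvg_unique Elim; apply: fps_cvg_ext (fps_cvgM (qpoch_cvg _ t r0) (fps_cvg_cst _)).
  exact: Eprod.
suff <- : E t = (qpoch (fpsX ^+ t) q)^-1 by exact: Ecvg.
have U : qpoch (fpsX ^+ t) q \is a GRing.unit by exact: qpoch_unit.
by apply: (mulrI U); rewrite E1 divrr.
Qed.

(** The factors 1 - q^i are sorted by the residue of i modulo 3. *)
Lemma qpoch_trisect (R : comUnitRingType) r : (0 < r)%N ->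
  qpoch (fpsX ^+ r) (fpsX ^+ r) =
  qpoch (fpsX ^+ r) (fpsX ^+ (r + 2 * r)) * qpoch (fpsX ^+ (2 * r)) (fpsX ^+ (r + 2 * r))
  * qpoch (fpsX ^+ (r + 2 * r)) (fpsX ^+ (r + 2 * r)) :> {fps R}.
Proof.
move=> r0; have r1 : (0 < r + 2 * r)%N by lia.
apply: (@fps_cvg_unique _ (fun m => qpochn (fpsX ^+ r) (fpsX ^+ r) (3 * m))).
  by apply: fps_cvg_comp (qpoch_cvg _ r r0) => N; exists N => m; lia.
apply: fps_cvg_ext (fps_cvgM (fps_cvgM (qpoch_cvg _ r r1) (qpoch_cvg _ (2 * r) r1))
  (qpoch_cvg _ (r + 2 * r) r1)) => m.
elim: m => [|m IH]; first by rewrite muln0 /qpochn !big_geq // !mulr1.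
rewrite !big_nat_recr //= (_ : 3 * m.+1 = (3 * m).+3)%N ?mulnS // !qpochnS -{}IH.
have -> : fpsX ^+ (r + 2 * r) = (fpsX ^+ r) ^+ 3 :> {fps R} by rewrite -exprM; congr (_ ^+ _); lia.
have -> : fpsX ^+ (2 * r) = (fpsX ^+ r) ^+ 2 :> {fps R} by rewrite mulnC exprM.
move: (fpsX ^+ r) => x; rewrite -(exprM x 3 m) !exprS; move: (x ^+ (3 * m)) => y; ring.
Qed.

(** * Non-negative power series *)

Definition nonneg (f : {fps int}) := forall n, 0 <= coef f n.

Lemma nonneg0 : nonneg 0. Proof. by move=> n. Qed.

Lemma nonneg1 : nonneg 1. Proof. by move=> n; rewrite coef_fps1; case: eqP. Qed.

Lemma nonnegD f g : nonneg f -> nonneg g -> nonneg (f + g).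
Proof. by move=> f0 g0 n; rewrite coef_fpsD addr_ge0. Qed.

Lemma nonnegM f g : nonneg f -> nonneg g -> nonneg (f * g).
Proof. by move=> f0 g0 n; rewrite coef_fpsM sumr_ge0 // => i _; rewrite mulr_ge0. Qed.

Lemma nonneg_expr f d : nonneg f -> nonneg (f ^+ d).
Proof.
by move=> f0; elim: d => [|d IH]; [exact: nonneg1 | rewrite exprS; exact: nonnegM].
Qed.

Lemma nonneg_fpsXn d : nonneg (fpsX ^+ d).
Proof. by apply: nonneg_expr => n /=; case: eqP. Qed.

Lemma nonneg_sum (u : nat -> {fps int}) J :
  (forall j, nonneg (u j)) -> nonneg (\sum_(0 <= j < J) u j).
Proof.
by move=> u0 n; rewrite coef_fps_bigsum sumr_ge0 // => j _; exact: u0.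
Qed.

(** The first two terms are exempt because a double sum over m, n < M contains
    its terms (0, 0) and (1, 1) only from M = 2 on. *)
Lemma nonneg_fps_cvg (u : nat -> {fps int}) f :
  fps_cvg u f -> (forall m, nonneg (u m.+2)) -> nonneg f.
Proof.
move=> uf u0 n; have [N HN] := uf n; rewrite -(HN N.+2) ?u0 //; lia.
Qed.

(** The inverse g satisfies g = 1 + X^d g, which determines its coefficients
    recursively from non-negative ones. *)
Lemma nonneg_geom d : (0 < d)%N -> nonneg (1 - fpsX ^+ d)^-1.
Proof.
move=> d0; set g := _^-1.
have gE : g = 1 + fpsX ^+ d * g.
  have U : (1 - fpsX ^+ d : {fps int}) \is a GRing.unit by exact: one_sub_fpsXn_unit.
  by apply/eqP; rewrite -subr_eq; apply/eqP; rewrite -{1}[g]mul1r -mulrBl divrr.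
elim/ltn_ind => n IH; rewrite gE coef_fpsD; apply: addr_ge0; first exact: nonneg1.
by rewrite coef_fpsXnM; case: ltnP => // dn; apply: IH; lia.
Qed.

Lemma one_sub_mul_inv_qfact (A : comUnitRingType) (q : A) m :
  (forall i, 1 - q ^+ i.+1 \is a GRing.unit) ->
  (1 - q ^+ m) * inv_qfact q m = if m is m'.+1 then inv_qfact q m' else 0.
Proof.
move=> hq; case: m => [|m]; first by rewrite expr0 subrr mul0r.
by rewrite mulrC -inv_qfactS.
Qed.

Lemma inv_qfact_rec (A : comUnitRingType) (q : A) m :
  (forall i, 1 - q ^+ i.+1 \is a GRing.unit) ->
  inv_qfact q m.+1 = inv_qfact q m * (1 - q ^+ m.+1)^-1.
Proof. by move=> hq; rewrite (inv_qfactS m hq) mulrK. Qed.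

(** * Weighted pairs of partitions *)

(** The series g_m g_n counts pairs of partitions with parts at most m and at
    most n. The lemmas below show that it remains non-negative after
    multiplication by factors 1 - q^i slightly below i = m + n. *)

Section PairsOfPartitions.
Variable r : nat.
Hypothesis r0 : (0 < r)%N.
Let q : {fps int} := fpsX ^+ r.
Let g := inv_qfact q.
Let hq : forall i, 1 - q ^+ i.+1 \is a GRing.unit.
Proof. by move=> i; exact: one_sub_fpsXnX_unit. Qed.

Lemma nonneg_qXn m : nonneg (q ^+ m).
Proof. by rewrite -exprM; exact: nonneg_fpsXn. Qed.

Lemma nonneg_geom_qXn m : nonneg (1 - q ^+ m.+1)^-1.
Proof. by rewrite -exprM; apply: nonneg_geom; rewrite muln_gt0 r0. Qed.

Lemma nonneg_inv_qfact m : nonneg (g m).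
Proof.
elim: m => [|m IH]; first by rewrite /g inv_qfact0; exact: nonneg1.
by rewrite /g inv_qfact_rec //; exact: nonnegM (nonneg_geom_qXn _).
Qed.

Lemma nonneg_one_sub_inv_qfact m : nonneg ((1 - q ^+ m) * g m).
Proof.
rewrite /g one_sub_mul_inv_qfact //; case: m => [|m]; [exact: nonneg0 | exact: nonneg_inv_qfact].
Qed.

Lemma nonneg_one_sub_inv_qfactS m : nonneg ((1 - q ^+ m) * g m.+1).
Proof.
rewrite /g inv_qfact_rec // mulrA.
exact: nonnegM (nonneg_one_sub_inv_qfact _) (nonneg_geom_qXn _).
Qed.

Lemma nonneg_one_sub2_inv_qfactS m : nonneg ((1 - q ^+ m) * (1 - q ^+ m.+1) * g m.+1).
Proof.
by rewrite -mulrA [X in _ * X]mulrC -inv_qfactS //; exact: nonneg_one_sub_inv_qfact.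
Qed.

(** Splitting 1 - q^(i + n) = (1 - q^i) + q^i (1 - q^n) with i = m - 1 leaves
    in each summand a factor that cancels one of g_m and g_n. *)
Lemma nonneg_one_sub_inv_qfact_pair m n :
  (0 < m + n)%N -> nonneg ((1 - q ^+ (m + n).-1) * (g m * g n)).
Proof.
wlog m0 : m n / (0 < m)%N => [H mn|_].
  have [m0|m0] := posnP m; last exact: H.
  rewrite m0 add0n in mn *; case: n mn => // n _ /=.
  by rewrite mulrCA; apply: nonnegM (nonneg_inv_qfact _) (nonneg_one_sub_inv_qfactS _).
case: m m0 => // m _; rewrite addSn /= exprD.
rewrite (_ : _ * _ = (1 - q ^+ m) * g m.+1 * g n
   + q ^+ m * g m.+1 * ((1 - q ^+ n) * g n)); last by ring.
apply: nonnegD; apply: nonnegM => //.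
- exact: nonneg_one_sub_inv_qfactS.
- exact: nonneg_inv_qfact.
- by apply: nonnegM; [exact: nonneg_qXn | exact: nonneg_inv_qfact].
- exact: nonneg_one_sub_inv_qfact.
Qed.

(** Splitting both factors as in [nonneg_one_sub_inv_qfact_pair] produces only
    products in which at most two consecutive factors fall on the same g. If m
    or n is 0, the other index can be 1, where the truncated exponent
    (m + n).-2 is harmless because the second factor vanishes. *)
Lemma nonneg_one_sub2_inv_qfact_pair m n : (0 < m + n)%N ->
  nonneg ((1 - q ^+ (m + n).-2) * (1 - q ^+ (m + n).-1) * (g m * g n)).
Proof.
have H0 m' : nonneg ((1 - q ^+ m'.+1.-2) * (1 - q ^+ m'.+1.-1) * (g m'.+1 * g 0)).
  rewrite /g inv_qfact0 mulr1 -/g /=; case: m' => [|m' /=].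
    by rewrite subrr mulr0 mul0r; exact: nonneg0.
  rewrite /g inv_qfact_rec // mulrA.
  exact: nonnegM (nonneg_one_sub2_inv_qfactS _) (nonneg_geom_qXn _).
case: m n => [|m] [|n] // _.
- by rewrite add0n [g _ * _]mulrC; exact: H0.
- by rewrite addn0; exact: H0.
rewrite addSn addnS /= !exprS exprD.
have A := nonneg_one_sub2_inv_qfactS m; have B := nonneg_one_sub2_inv_qfactS n.
have A' := nonneg_one_sub_inv_qfactS m; have B' := nonneg_one_sub_inv_qfactS n.
rewrite !exprS in A B.
have qm := nonneg_qXn m; have qn := nonneg_qXn n.
have gm := nonneg_inv_qfact m.+1; have gn := nonneg_inv_qfact n.+1.
have q1 : nonneg q by rewrite -[q]expr1; exact: nonneg_qXn.
move: A B A' B' qm qn gm gn; set x := q ^+ m; set y := q ^+ n; set G := g m.+1; set H := g n.+1.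
move=> A B A' B' qm qn gm gn.
rewrite (_ : _ * (G * H) = (1 - x) * (1 - q * x) * G * H + x * G * ((1 - y) * (1 - q * y) * H)
   + (1 + y) * (q * x) * (((1 - x) * G) * ((1 - y) * H))); last by ring.
apply: nonnegD; first by apply: nonnegD; apply: nonnegM => //; exact: nonnegM.
apply: nonnegM; last exact: nonnegM.
by apply: nonnegM; [apply: nonnegD => //; exact: nonneg1 | exact: nonnegM].
Qed.

End PairsOfPartitions.

(** * The pentagonal number series and its tail *)

Lemma pentagonal_number (R : comUnitRingType) r : (0 < r)%N ->
  fps_sum 0 (fun j => (-1) ^+ j * theta_term (fpsX ^+ r) (fpsX ^+ (2 * r)) j)
  = qpoch (fpsX ^+ r) (fpsX ^+ r) :> {fps R}.
Proof. by move=> r0; rewrite jacobi_triple_product ?muln_gt0 // -qpoch_trisect. Qed.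

(** The pentagonal number j (3j + 1) / 2, in the form in which it comes out of
    [theta_term]. *)
Definition pent_exp j := ('C(j, 2) + 2 * 'C(j.+1, 2))%N.

Lemma pent_expS j : pent_exp j.+1 = (pent_exp j + (2 * j).+1 + j.+1)%N.
Proof. by rewrite /pent_exp !binS bin1 bin0; lia. Qed.

Lemma theta_term_pent r j : theta_term (fpsX ^+ r) (fpsX ^+ (2 * r)) j
  = (fpsX ^+ r) ^+ pent_exp j * (1 - (fpsX ^+ r) ^+ (2 * j).+1) :> {fps int}.
Proof.
rewrite theta_termX -!exprM /pent_exp addn1; congr (fpsX ^+ _ * _); lia.
Qed.

Lemma nonneg_geom_sum r d : (0 < r)%N ->
  nonneg ((1 - (fpsX ^+ r) ^+ d) * (1 - fpsX ^+ r)^-1).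
Proof.
move=> r0; have U : (1 - fpsX ^+ r : {fps int}) \is a GRing.unit by exact: one_sub_fpsXn_unit.
have -> : 1 - (fpsX ^+ r) ^+ d = (1 - fpsX ^+ r) * \sum_(0 <= i < d) (fpsX ^+ r) ^+ i :> {fps int}.
  by rewrite big_mkord -opprB subrX1 -mulNr opprB.
rewrite mulrAC divrr // mul1r; apply: nonneg_sum => j; rewrite -exprM; exact: nonneg_fpsXn.
Qed.

(** The geometric sum (q^e - q^e') / (1 - q), for e and e' the j-th and (j+1)-th
    values of [pent_exp], contains both exponents e and e + 2j + 1 of the j-th
    theta term, so it dominates that term with either sign. *)
Lemma nonneg_pent_step (b : bool) r j : (0 < r)%N -> let q : {fps int} := fpsX ^+ r in
  nonneg ((q ^+ pent_exp j - q ^+ pent_exp j.+1) * (1 - q)^-1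
          + (-1) ^+ b * (q ^+ pent_exp j * (1 - q ^+ (2 * j).+1))).
Proof.
move=> r0 q; have U : (1 - q) \is a GRing.unit by exact: one_sub_fpsXn_unit.
have qn d : nonneg (q ^+ d) by rewrite -exprM; exact: nonneg_fpsXn.
have G d : nonneg ((1 - q ^+ d) * (1 - q)^-1) by exact: nonneg_geom_sum.
have hE : q * (1 - q)^-1 = (1 - q)^-1 - 1.
  by rewrite -{3}(divrr U) -[X in _ = X - _]mul1r -mulrBl; congr (_ * _); ring.
rewrite pent_expS; move: (pent_exp j) => E; rewrite !exprD.
have := qn E; set e := q ^+ E => en.
case: b; last first.
  rewrite (_ : _ + _ = e * ((1 - q ^+ (2 * j).+1) * (1 - q)^-1 + 1
     + q ^+ (2 * j).+2 * ((1 - q ^+ j) * (1 - q)^-1))).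
    apply: nonnegM => //; apply: nonnegD; last exact: nonnegM.
    by apply: nonnegD => //; exact: nonneg1.
  rewrite -[(-1) ^+ false]/1 (exprS q (2 * j).+1) (exprS q j).
  move: hE; set h := _^-1; set x := q ^+ _.+1; set y := q ^+ j => hE.
  apply/eqP; rewrite -subr_eq0.
  rewrite (_ : _ - _ = e * x * (h - 1 - q * h)); first by rewrite hE subrr mulr0.
  by ring.
rewrite (_ : _ + _ = e * (q * ((1 - q ^+ (2 * j + j).+1) * (1 - q)^-1) + q ^+ (2 * j).+1)).
  apply: nonnegM => //; apply: nonnegD => //; apply: nonnegM => //.
  by rewrite -[q]expr1.
rewrite -[(-1) ^+ true]/(-1) !exprS exprD.
move: hE; set h := _^-1; set x := q ^+ _; set y := q ^+ j => hE.
apply/eqP; rewrite -subr_eq0.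
rewrite (_ : _ - _ = e * (h - 1 - q * h)); first by rewrite hE subrr mulr0.
by ring.
Qed.

(** Summing [nonneg_pent_step] over j >= k telescopes to q^e / (1 - q). *)
Lemma nonneg_pent_tail (b : bool) r k : (0 < r)%N -> let q : {fps int} := fpsX ^+ r in
  nonneg (q ^+ pent_exp k * (1 - q)^-1
     + (-1) ^+ b * (qpoch q q - \sum_(0 <= j < k) (-1) ^+ j * theta_term q (fpsX ^+ (2 * r)) j)).
Proof.
move=> r0 q; pose t j := (-1) ^+ j * theta_term q (fpsX ^+ (2 * r)) j.
have t0 n j : (n < j)%N -> coef (t j) n = 0.
  by move=> nj; rewrite -[t j]mulr1 coef_theta_small // muln_gt0.
rewrite -pentagonal_number // -/t -fps_sum_split //.
have lim : fps_cvg (fun d => q ^+ pent_exp k * (1 - q)^-1 + (-1) ^+ b * \sum_(k <= j < k + d) t j)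
    (q ^+ pent_exp k * (1 - q)^-1 + (-1) ^+ b * fps_sum k t).
  apply: fps_cvgD (fps_cvg_cst _) (fps_cvgM (fps_cvg_cst _) _).
  by apply: fps_cvg_comp (fps_sum_cvg k t0) => N; exists N => m; lia.
apply: nonneg_fps_cvg lim _ => m; move: m.+2 => {}m.
have qn d : nonneg (q ^+ d) by rewrite -exprM; exact: nonneg_fpsXn.
suff H : nonneg ((q ^+ pent_exp k - q ^+ pent_exp (k + m)) * (1 - q)^-1
                 + (-1) ^+ b * \sum_(k <= j < k + m) t j).
  rewrite (_ : _ + _ = (q ^+ pent_exp k - q ^+ pent_exp (k + m)) * (1 - q)^-1
     + (-1) ^+ b * \sum_(k <= j < k + m) t j + q ^+ pent_exp (k + m) * (1 - q)^-1).
    by apply: nonnegD => //; apply: nonnegM => //; exact: nonneg_geom.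
  by ring.
elim: m => [|m IH].
  by rewrite addn0 subrr mul0r big_geq // mulr0 add0r; exact: nonneg0.
rewrite addnS big_nat_recr ?leq_addr //=.
have := nonneg_pent_step (b (+) odd (k + m)) (k + m) r0 => /=.
rewrite -/q -theta_term_pent -/q signr_addb signr_odd -mulrA -/(t _) => H.
rewrite (_ : _ + _ = (q ^+ pent_exp k - q ^+ pent_exp (k + m)) * (1 - q)^-1 +
  (-1) ^+ b * \sum_(k <= j < k + m) t j + ((q ^+ pent_exp (k + m) - q ^+ pent_exp (k + m).+1) *
       (1 - q)^-1 + (-1) ^+ b * t (k + m)%N)); first exact: nonnegD.
by ring.
Qed.

(** * Double Euler expansion and comparison with the product *)

Lemma nonneg_double_sum (w : nat -> nat -> {fps int}) S :
  fps_cvg (fun M => \sum_(0 <= m < M) \sum_(0 <= n < M) w m n) S ->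
  (forall m n, (0 < m + n)%N -> nonneg (w m n)) -> nonneg (S - w 0%N 0%N - w 1%N 1%N).
Proof.
move=> cv w0.
apply: nonneg_fps_cvg (fps_cvgD (fps_cvgD cv (fps_cvg_cst _)) (fps_cvg_cst _)) _ => M.
have recl (u : nat -> {fps int}) J :
    \sum_(0 <= j < J.+1) u j = u 0%N + \sum_(0 <= j < J) u j.+1 by rewrite big_nat_recl.
rewrite (recl (fun m => \sum_(0 <= n < M.+2) w m n)) (recl (w 0%N)).
rewrite (recl (fun m => \sum_(0 <= n < M.+2) w m.+1 n)) (recl (w 1%N)) (recl (fun n => w 1%N n.+1)).
set A := \sum_(_ <= _ < _) _; set B := \sum_(_ <= _ < _) _; set C := \sum_(_ <= _ < _) _.
rewrite (_ : _ - _ - _ = A + (w 1%N 0%N + B + C)); last by ring.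
apply: nonnegD; first by apply: nonneg_sum => j; exact: w0.
apply: nonnegD; last by apply: nonneg_sum => j; apply: nonneg_sum => i; exact: w0.
by apply: nonnegD; [exact: w0|apply: nonneg_sum => j; exact: w0].
Qed.

Definition quad_weight {A : comUnitRingType} (c0 c1 c2 q : A) N :=
  c0 + c1 * q ^+ N + c2 * (q ^+ N) ^+ 2.

(** In the application s = S + R and t = R - S, so that s + t = 2 R; the index i
    counts the factors removed from each product. *)
Definition recip_qpoch_pair (R : comUnitRingType) s t r i : {fps R} :=
  (qpoch (fpsX ^+ (s + r * i)) (fpsX ^+ r) * qpoch (fpsX ^+ (t + r * i)) (fpsX ^+ r))^-1.

Lemma recip_qpoch_pairS (R : comUnitRingType) s t r i : (0 < s)%N -> (0 < t)%N -> (0 < r)%N ->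
  recip_qpoch_pair R s t r i.+1 = (1 - fpsX ^+ (s + r * i)) * (1 - fpsX ^+ (t + r * i))
     * recip_qpoch_pair R s t r i.
Proof.
move=> s0 t0 r0; rewrite /recip_qpoch_pair (qpoch_rec _ (s + r * i) r0)
  (qpoch_rec _ (t + r * i) r0).
rewrite -!addnA -mulnSr mulrACA [in RHS]invrM.
- by rewrite mulrCA divrr ?mulr1 // unitrM !one_sub_fpsXn_unit //; lia.
- by rewrite unitrM !one_sub_fpsXn_unit //; lia.
- by rewrite unitrM !qpoch_unit //; lia.
Qed.

(** Each of the two reciprocals is expanded by [euler_cvg]; removing i factors
    multiplies the (m, n) term by q^(i (m + n)). *)
Lemma double_euler_cvg (R : comUnitRingType) s t r i :
  (0 < s)%N -> (0 < t)%N -> (0 < r)%N -> let q : {fps R} := fpsX ^+ r in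
  fps_cvg (fun M => \sum_(0 <= m < M) \sum_(0 <= n < M)
     (fpsX ^+ s) ^+ m * (fpsX ^+ t) ^+ n * (q ^+ (m + n)) ^+ i * (inv_qfact q m * inv_qfact q n))
   (recip_qpoch_pair R s t r i).
Proof.
move=> s0 t0 r0 q.
have sU : qpoch (fpsX ^+ (s + r * i)) q \is a GRing.unit by rewrite qpoch_unit //; lia.
have tU : qpoch (fpsX ^+ (t + r * i)) q \is a GRing.unit by rewrite qpoch_unit //; lia.
have s1 : (0 < s + r * i)%N by lia.
have t1 : (0 < t + r * i)%N by lia.
rewrite /recip_qpoch_pair -/q invrM // mulrC.
apply: fps_cvg_ext (fps_cvgM (euler_cvg _ s1 r0) (euler_cvg _ t1 r0)) => M.
rewrite mulr_suml; apply: eq_bigr => m _; rewrite mulr_sumr; apply: eq_bigr => n _.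
rewrite !exprD !exprM -/q !exprMn -!exprM ![(i * _)%N]mulnC -/q; ring.
Qed.

Lemma quad_weight_cvg (R : comUnitRingType) s t r (c0 c1 c2 : {fps R}) :
  (0 < s)%N -> (0 < t)%N -> (0 < r)%N -> let q : {fps R} := fpsX ^+ r in
  fps_cvg (fun M => \sum_(0 <= m < M) \sum_(0 <= n < M)
     (fpsX ^+ s) ^+ m * (fpsX ^+ t) ^+ n
      * (quad_weight c0 c1 c2 q (m + n) * (inv_qfact q m * inv_qfact q n)))
   (c0 * recip_qpoch_pair R s t r 0 + c1 * recip_qpoch_pair R s t r 1
     + c2 * recip_qpoch_pair R s t r 2).
Proof.
move=> s0 t0 r0 q.
have D i c := fps_cvgM (fps_cvg_cst c) (@double_euler_cvg R s t r i s0 t0 r0).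
apply: fps_cvg_ext (fps_cvgD (fps_cvgD (D 0%N c0) (D 1%N c1)) (D 2%N c2)) => M.
rewrite !mulr_sumr -!big_split; apply: eq_bigr => m _ /=.
rewrite !mulr_sumr -!big_split; apply: eq_bigr => n _ /=.
rewrite /quad_weight -/q; ring.
Qed.

(** The two exceptional terms are compared with the product directly: the term
    (0, 0), whose weight may be negative, and the term (1, 1), which is
    q^2 W(2) / (1 - q)^2 because the two base monomials multiply to q^2. All
    other terms of the double sum are discarded, and the tail of the product
    after its first k pentagonal terms is replaced by its lower bound
    - q^e / (1 - q). *)
Lemma nonneg_quad_weight s t r (c0 c1 c2 : {fps int}) (b : bool) k :
  (0 < s)%N -> (0 < t)%N -> (0 < r)%N -> (s + t = 2 * r)%N -> let q : {fps int} := fpsX ^+ r in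
  (forall m n, (0 < m + n)%N ->
     nonneg (quad_weight c0 c1 c2 q (m + n) * (inv_qfact q m * inv_qfact q n))) ->
  nonneg (quad_weight c0 c1 c2 q 0 + q ^+ 2 * quad_weight c0 c1 c2 q 2 * (1 - q)^-1 ^+ 2
    + (-1) ^+ b * \sum_(0 <= j < k) (-1) ^+ j * (q ^+ pent_exp j * (1 - q ^+ (2 * j).+1))
    - q ^+ pent_exp k * (1 - q)^-1) ->
  nonneg (c0 * recip_qpoch_pair int s t r 0 + c1 * recip_qpoch_pair int s t r 1
    + c2 * recip_qpoch_pair int s t r 2 + (-1) ^+ b * qpoch q q).
Proof.
move=> s0 t0 r0 st q w0 H.
have xyn m n : nonneg ((fpsX ^+ s) ^+ m * (fpsX ^+ t) ^+ n).
  by rewrite -!exprM -exprD; exact: nonneg_fpsXn.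
have D := nonneg_double_sum (@quad_weight_cvg int s t r c0 c1 c2 s0 t0 r0)
  (fun m n mn => nonnegM (xyn m n) (w0 m n mn)).
rewrite -/q in D.
have T := nonneg_pent_tail b k r0; rewrite -/q in T.
have E : \sum_(0 <= j < k) (-1) ^+ j * (q ^+ pent_exp j * (1 - q ^+ (2 * j).+1))
   = \sum_(0 <= j < k) (-1) ^+ j * theta_term q (fpsX ^+ (2 * r)) j.
  by apply: eq_bigr => j _; rewrite theta_term_pent.
rewrite E in H; have := nonnegD (nonnegD D H) T.
have g1 : inv_qfact q 1 = (1 - q)^-1.
  by rewrite /inv_qfact qpochnS /qpochn big_geq // mul1r expr0 mulr1.
have xy : fpsX ^+ s * fpsX ^+ t = q ^+ 2 :> {fps int} by rewrite -exprD st -exprM mulnC.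
rewrite !expr1 xy g1 !expr0 inv_qfact0.
set G := c0 * recip_qpoch_pair int s t r 0 + c1 * recip_qpoch_pair int s t r 1
  + c2 * recip_qpoch_pair int s t r 2.
set sg := (-1) ^+ b; set h := _^-1; set P := qpoch _ _; set e := q ^+ pent_exp k.
rewrite -[(1 + 1)%N]/2%N -[(0 + 0)%N]/0%N.
set w := quad_weight _ _ _ _ 2; set w' := quad_weight _ _ _ _ 0.
set S := \sum_(_ <= _ < _) _.
by rewrite [X in nonneg X -> _](_ : _ = G + sg * P) //; ring.
Qed.

Lemma theta_expE S R j : (S <= R)%N ->
  ((R * (j * j.+1)) %/ 2 - S * j = S * 'C(j, 2) + (R - S) * 'C(j.+1, 2))%N.
Proof.
move=> SR; have -> : (j * j.+1 = 'C(j.+1, 2) * 2)%N.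
  by elim: j => // j IH; rewrite binS bin1 mulnDl -IH; lia.
by rewrite mulnA mulnK // binS bin1; nia.
Qed.

(** * Truncated theta series *)

Theorem theorem1p1 (k R S : nat) (hk : k \in [:: 1; 2; 3]%N)
    (hS : (1 <= S)%N) (hSR : (S < R)%N) (n : nat) :
  0 <= coef ((-1) ^+ k
             / (qpoch (fpsX ^+ S) (fpsX ^+ R) * qpoch (fpsX ^+ (R - S)) (fpsX ^+ R))
             * fps_sum k (fun j => (-1) ^+ j * fpsX ^+ ((R * (j * j.+1)) %/ 2 - S * j)
                                   * (1 - fpsX ^+ (S * (2 * j + 1))))
             : {fps int}) n.
Proof.
have R0 : (0 < R)%N by lia.
have T0 : (0 < R - S)%N by lia.
have SR0 : (0 < S + R)%N by lia.
set q : {fps int} := fpsX ^+ R; set a : {fps int} := fpsX ^+ S.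
set b : {fps int} := fpsX ^+ (R - S).
pose t j := (-1) ^+ j * theta_term a b j.
have t0 m j : (m < j)%N -> coef (t j) m = 0.
  by move=> mj; rewrite -[t j]mulr1 coef_theta_small.
rewrite [X in fps_sum k X](_ : _ = t); last first.
  apply: boolp.funext => j; rewrite /t theta_termX mulrA; congr (_ * fpsX ^+ _ * _).
  exact: theta_expE (ltnW hSR).
set L := (_ * _)^-1.
have aU : 1 - a \is a GRing.unit by exact: one_sub_fpsXn_unit.
have L0 : recip_qpoch_pair int (S + R) (R - S) R 0 = (1 - a) * L.
  rewrite /recip_qpoch_pair /L muln0 !addn0 (qpoch_rec _ S R0) -/a -mulrA.
  by rewrite [in RHS]invrM ?unitrM ?qpoch_unit // mulrCA divrr ?mulr1.
have aq : fpsX ^+ (S + R) = a * q by rewrite exprD.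
have qE : q = a * b by rewrite -exprD; congr (_ ^+ _); lia.
have L1 : recip_qpoch_pair int (S + R) (R - S) R 1 = (1 - a * q) * (1 - b) * ((1 - a) * L).
  by rewrite recip_qpoch_pairS // muln0 !addn0 L0 aq.
have L2 : recip_qpoch_pair int (S + R) (R - S) R 2 =
    (1 - a * q ^+ 2) * (1 - b * q) * ((1 - a * q) * (1 - b) * ((1 - a) * L)).
  by rewrite recip_qpoch_pairS // muln1 L1 !exprD -/a -/b -/q expr2 (mulrA a).
have JTP : fps_sum k t = L^-1 * qpoch q q - \sum_(0 <= j < k) t j.
  have J := @jacobi_triple_product int S (R - S) hS T0.
  rewrite subnKC ?(ltnW hSR) // in J.
  by rewrite (fps_sum_split k t0) invrK -J.
have LU : L \is a GRing.unit by rewrite unitrV unitrM !qpoch_unit.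
rewrite JTP -mulrA (mulrBr L) mulVKr //; clear JTP t0.
have hU i : 1 - q ^+ i.+1 \is a GRing.unit by exact: one_sub_fpsXnX_unit.
set P := qpoch q q.
set h := (1 - q)^-1.
have hE : q * h = h - 1.
  by rewrite /h -{3}(divrr (hU 0%N)) -[X in _ = X - _]mul1r -mulrBl; congr (_ * _); ring.
have qX d : nonneg (q ^+ d) by rewrite -exprM; exact: nonneg_fpsXn.
have q1 : nonneg q by exact: nonneg_fpsXn.
have hn : nonneg h by exact: nonneg_geom.
have gg m n' : nonneg (inv_qfact q m * inv_qfact q n').
  by apply: nonnegM; exact: nonneg_inv_qfact.
have p0 : pent_exp 0 = 0%N by [].
have p1 : pent_exp 1 = 2%N by [].
have p2 : pent_exp 2 = 7%N by [].
(* It suffices to expand T_k in the products (aq;q)_i (b;q)_i, check the weight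
   W for m + n > 0, and settle the comparison of [nonneg_quad_weight]. *)
have main (c0 c1 c2 : {fps int}) k' :
    \sum_(0 <= j < k) t j = - (-1) ^+ k * ((1 - a) * (c0 + (1 - a * q) * (1 - b)
         * (c1 + (1 - a * q ^+ 2) * (1 - b * q) * c2))) ->
    (forall m n, (0 < m + n)%N ->
     nonneg (quad_weight c0 c1 c2 q (m + n) * (inv_qfact q m * inv_qfact q n))) ->
    nonneg (quad_weight c0 c1 c2 q 0 + q ^+ 2 * quad_weight c0 c1 c2 q 2 * h ^+ 2
      + (-1) ^+ k * \sum_(0 <= j < k') (-1) ^+ j * (q ^+ pent_exp j * (1 - q ^+ (2 * j).+1))
      - q ^+ pent_exp k' * h) ->
    nonneg ((-1) ^+ k * (P - L * \sum_(0 <= j < k) t j)).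
  move=> tE w0 H.
  have st : (S + R + (R - S) = 2 * R)%N by lia.
  have := @nonneg_quad_weight (S + R) (R - S) R c0 c1 c2 (odd k) k' SR0 T0 R0 st w0.
  rewrite signr_odd => /(_ H); rewrite tE L0 L1 L2 -/q -/P.
  have sg2 : (-1) ^+ k * (-1) ^+ k = 1 :> {fps int} by rewrite -expr2 sqrr_sign.
  set sg := (-1) ^+ k in sg2 *.
  set Z1 := (X in nonneg X -> _); set Z2 := (X in _ -> nonneg X).
  rewrite (_ : Z2 = Z1) //; apply/eqP; rewrite -subr_eq0.
  rewrite (_ : _ - _ = (sg * sg - 1) * L * ((1 - a) * (c0 + (1 - a * q) * (1 - b)
         * (c1 + (1 - a * q ^+ 2) * (1 - b * q) * c2)))); first by rewrite sg2 subrr !mul0r.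
  by rewrite /Z1 /Z2; ring.
rewrite -/(nonneg _); move: n.
move: hk main; rewrite !inE => /or3P[] /eqP -> main.
- apply: (main 1 0 0 1%N).
  + by rewrite big_nat1 /t /theta_term; ring.
  + by move=> m n' _; rewrite /quad_weight !mul0r !addr0 mul1r.
  + rewrite big_nat1 p0 p1 /quad_weight.
    (* The difference is q + q^3 / (1 - q)^2, since h - 1 - q h = 0. *)
    rewrite (_ : _ - _ = q + q ^+ 2 * (q * h * h) + q ^+ 2 * h * (h - 1 - q * h)); last by ring.
    rewrite hE subrr mulr0 addr0 -hE; apply: nonnegD => //; apply: nonnegM => //.
    by apply: nonnegM => //; exact: nonnegM.
- apply: (main (q + q ^+ 2) (- 1) 0 1%N).
  + by rewrite big_nat_recr //= big_nat1 /t /theta_term !binS !bin0 !bin_small // qE; ring.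
  + move=> m n' mn; rewrite /quad_weight.
    have := nonneg_one_sub_inv_qfact_pair R0 mn; rewrite -/q.
    have := gg m n'; move: mn; case: (m + n')%N => // N _; set g := _ * _ => g0 /= H1.
    rewrite (exprS q N); set x := q ^+ N in H1 *.
    rewrite (_ : _ * g = q * ((1 - x) * g) + q ^+ 2 * g); last by ring.
    by apply: nonnegD; apply: nonnegM.
  + rewrite big_nat1 p0 p1 /quad_weight.
    (* The difference is q^4 / (1 - q)^2, since 1 + q h - h = 0. *)
    rewrite (_ : _ - _ = q ^+ 4 * h ^+ 2 + (q ^+ 2 - q ^+ 3 * h) * (1 + q * h - h)); last by ring.
    have -> : 1 + q * h - h = 0 by rewrite hE; ring.
    by rewrite mulr0 addr0; apply: nonnegM => //; exact: nonnegM.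
- apply: (main (q ^+ 3 + q ^+ 4 + q ^+ 5) (- (q + q ^+ 2 + q ^+ 3 + q ^+ 4)) 1 2%N).
  + rewrite big_nat_recr //= big_nat_recr //= big_nat1 /t /theta_term.
    by rewrite !binS !bin0 !bin_small // qE; ring.
  + move=> m n' mn; rewrite /quad_weight.
    have := nonneg_one_sub_inv_qfact_pair R0 mn.
    have := nonneg_one_sub2_inv_qfact_pair R0 mn; rewrite -/q.
    have := gg m n'; move: mn; case: (m + n')%N => [|[|N]] // _; set g := _ * _ => g0 /= H2 H1.
      (* The weight vanishes at N = 1; the factored form needs N >= 2. *)
      by rewrite (_ : _ * g = 0); [exact: nonneg0|ring].
    rewrite (exprS q N) in H1 H2; rewrite (exprS q N.+1) (exprS q N).
    set x := q ^+ N in H1 H2 *.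
    rewrite (_ : _ * g = q ^+ 3 * ((1 - x) * (1 - q * x) * g)
      + (q ^+ 4 + q ^+ 5) * ((1 - q * x) * g)); last by ring.
    by apply: nonnegD; apply: nonnegM => //; exact: nonnegD.
  + rewrite big_nat_recr //= big_nat1 p0 p1 p2 /quad_weight.
    (* The difference is q^6 / (1 - q), since h - 1 - q h = 0. *)
    rewrite (_ : _ - _ = q ^+ 6 * h + q ^+ 6 * h * (1 + q) * (h - 1 - q * h)); last by ring.
    by rewrite hE subrr mulr0 addr0; exact: nonnegM.
Qed.
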